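(* For integers $n\ge2$ and $0\le t\le n-2$, the number of $(102,021)$-avoiding inversion sequences $e$ of length $n$ with $\mathrm{rank}(e)=t$ is $$(t+1)\left(2^{n-t-2}-(n-t-1)+\sum_{m=1}^{n-t-1}\frac{1}{m+t+1}\binom{2m+t}{m}\right).$$
   Context: An inversion sequence of length $n$ is an integer sequence $e=(e_1,\dots,e_n)$ with $0\le e_j\le j-1$ for all $j$. It contains a pattern $w=w_1w_2w_3$ if there are indices $i_1<i_2<i_3$ such that $e_{i_1}e_{i_2}e_{i_3}$ is order-isomorphic to $w$ (same relations $<,=,>$ between corresponding pairs of entries); otherwise it avoids $w$. ''$(w,w')$-avoiding'' means avoiding both $w$ and $w'$. $\max(e)$ is the largest entry, and $\mathrm{fdes}(e)$ is the position $p$ of the first descent: $e_1\le\cdots\le e_p>e_{p+1}$, with the convention $e_{n+1}=-1$. For a $102$-avoiding $e$, $\mathrm{rank}(e):=\mathrm{fdes}(e)-\max(e)-1$. *)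

(* Defs.v *)
From mathcomp Require Import all_boot all_order all_algebra.
Set Implicit Arguments.
Unset Strict Implicit.
Unset Printing Implicit Defensive.
Import GRing.Theory Num.Theory.

(* The entry e_j (1 <= j <= n) is [e i] with i = j - 1; an entry of an
   inversion sequence is at most n - 1, hence the codomain 'I_n. *)
Definition is_inversion_sequence n (e : {ffun 'I_n -> 'I_n}) : bool :=
  [forall i : 'I_n, e i <= i].

Definition order_isomorphic (s w : seq nat) : bool :=
  (size s == size w) &&
  [forall i : 'I_(size w), forall j : 'I_(size w),
     ((nth 0 s i < nth 0 s j) == (nth 0 w i < nth 0 w j)) &&
     ((nth 0 s i == nth 0 s j) == (nth 0 w i == nth 0 w j))].

(* w is the word of a pattern of length 3, e.g. [:: 1; 0; 2] for 102. *)
Definition contains n (e : {ffun 'I_n -> 'I_n}) (w : 3.-tuple nat) : bool :=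
  [exists i1 : 'I_n, exists i2 : 'I_n, exists i3 : 'I_n,
     [&& i1 < i2, i2 < i3 &
         order_isomorphic [:: val (e i1); val (e i2); val (e i3)] w]].

Definition avoids n (e : {ffun 'I_n -> 'I_n}) (w : 3.-tuple nat) : bool :=
  ~~ contains e w.

Definition max_entry n (e : {ffun 'I_n -> 'I_n}) : nat := \max_(i < n) e i.

(* [entry e j] is e_(j+1); the default value of [nth] provides the
   convention e_(n+1) = -1. *)
Definition entry n (e : {ffun 'I_n -> 'I_n}) (j : nat) : int :=
  nth (-1)%R [seq Posz (e i) | i <- enum 'I_n] j.

(* The outer successor turns the 0-based index of the first descent into the
   1-based position fdes. For n >= 1 the search succeeds, at the latest at
   index n - 1. *)
Definition fdes n (e : {ffun 'I_n -> 'I_n}) : nat :=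
  (find (fun j => (entry e j.+1 < entry e j)%R) (iota 0 n)).+1.

Definition rank n (e : {ffun 'I_n -> 'I_n}) : int :=
  (Posz (fdes e) - Posz (max_entry e) - 1)%R.

(* Main.v *)
Require Import Defs.
From mathcomp Require Import all_boot all_order all_algebra.
From mathcomp Require Import zify ring.
Import GRing.Theory Num.Theory.

(* Let p = fdes e and m = max e, so that rank e = t means p = m + t + 1.
   Since e_1 = 0, avoiding 021 makes the nonzero entries weakly increasing, and
   avoiding 102 bounds everything after the first descent by e_p = m. Hence
   e_(p+1) = 0 and all later entries are 0 or m. If they all vanish, e is
   determined by its weakly increasing prefix ending in m, and such prefixes
   are counted by a ballot number. If m recurs after position p, avoiding 102
   forces the prefix to be 0^a m^(p-a) with m <= a < p, and the n - p - 1 free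
   entries form any nonzero word over {0, m}; this gives
   (t + 1) (2^(n-p-1) - 1) sequences. Summing over m gives the formula. *)

Local Open Scope ring_scope.
Local Open Scope nat_scope.

(** * Inversion sequences as lists of naturals *)

Definition word {n} (e : {ffun 'I_n -> 'I_n}) : seq nat :=
  [seq val (e i) | i <- enum 'I_n].

Lemma size_word n (e : {ffun 'I_n -> 'I_n}) : size (word e) = n.
Proof. by rewrite size_map size_enum_ord. Qed.

Lemma nth_word {n} (e : {ffun 'I_n -> 'I_n}) (i : 'I_n) : nth 0 (word e) i = e i.
Proof. by rewrite (nth_map i) ?size_enum_ord ?nth_ord_enum. Qed.

Lemma word_inj {n} : injective (@word n).
Proof.
move=> e e' ee'; apply/ffunP => i; apply: val_inj.
by rewrite /= -!nth_word ee'.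
Qed.

(** The inversion bound keeps every entry below n, so the entries fit into the codomain ['I_n]. *)
Lemma wordP n (w : seq nat) :
  size w = n -> (forall i, i < n -> nth 0 w i <= i) ->
  exists e : {ffun 'I_n -> 'I_n}, word e = w.
Proof.
move=> sw inv.
have b (i : 'I_n) : nth 0 w i < n by exact: leq_ltn_trans (inv _ _) _.
exists [ffun i => Ordinal (b i)].
apply: (@eq_from_nth _ 0); rewrite size_word ?sw// => i lin.
by rewrite (nth_word (n:=n) [ffun i => Ordinal (b i)] (Ordinal lin)) ffunE.
Qed.

Lemma is_inversion_sequenceP n (e : {ffun 'I_n -> 'I_n}) :
  reflect (forall i, i < n -> nth 0 (word e) i <= i) (is_inversion_sequence e).
Proof.
apply: (iffP forallP) => [h i lin|h i]; last by rewrite -nth_word h.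
by rewrite (nth_word e (Ordinal lin)) h.
Qed.

(** The letters of the pattern are distinct, so two comparisons between neighbours in sorted order
    determine all the others by transitivity. *)
Lemma order_isomorphic_102 a b c :
  order_isomorphic [:: a; b; c] [tuple 1; 0; 2] = (b < a < c).
Proof.
apply/idP/idP => [/andP[_ /forallP h]|h].
  have /forallP/(_ ord0)/= := h (Ordinal (isT : 1 < 3)).
  have /forallP/(_ (Ordinal (isT : 2 < 3)))/= := h ord0.
  by lia.
apply/andP; split=> //; apply/forallP => -[[|[|[|i]]] Hi] //;
  by apply/forallP => -[[|[|[|j]]] Hj] //=; lia.
Qed.

Lemma order_isomorphic_021 a b c :
  order_isomorphic [:: a; b; c] [tuple 0; 2; 1] = (a < c < b).
Proof.
apply/idP/idP => [/andP[_ /forallP h]|h].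
  have /forallP/(_ (Ordinal (isT : 2 < 3)))/= := h ord0.
  have /forallP/(_ (Ordinal (isT : 1 < 3)))/= := h (Ordinal (isT : 2 < 3)).
  by lia.
apply/andP; split=> //; apply/forallP => -[[|[|[|i]]] Hi] //;
  by apply/forallP => -[[|[|[|j]]] Hj] //=; lia.
Qed.

Lemma avoidsP {n} (e : {ffun 'I_n -> 'I_n}) (pat : 3.-tuple nat) :
  reflect (forall i j k, i < j -> j < k -> k < n ->
             ~~ order_isomorphic
                  [:: nth 0 (word e) i; nth 0 (word e) j; nth 0 (word e) k] pat)
          (avoids e pat).
Proof.
apply: (iffP idP) => [av i j k ij jk kn|h].
  have jn := ltn_trans jk kn; have lin := ltn_trans ij jn.
  apply: contra av => iso; apply/existsP; exists (Ordinal lin).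
  apply/existsP; exists (Ordinal jn); apply/existsP; exists (Ordinal kn).
  move: iso; rewrite (nth_word e (Ordinal lin)) (nth_word e (Ordinal jn)).
  by rewrite (nth_word e (Ordinal kn)) /= ij jk.
apply/negP => /existsP[i /existsP[j /existsP[k /and3P[ij jk]]]].
by rewrite /= -!nth_word; apply/negP/h.
Qed.

(** * First descent and maximum on lists *)

Definition first_descent (w : seq nat) p :=
  [/\ 0 < p <= size w,
      forall i, i.+1 < p -> nth 0 w i <= nth 0 w i.+1
    & p < size w -> nth 0 w p < nth 0 w p.-1].

Lemma first_descent_unique {w p q} :
  first_descent w p -> first_descent w q -> p = q.
Proof.
wlog pq : p q / p < q.
  by case: (ltngtP p q) => // pq h wp wq; [|symmetry]; apply: h pq _ _.
case=> /andP[p0 _] _ dp [/andP[_ qw] iq _].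
have := dp (leq_trans pq qw); have := iq p.-1; rewrite prednK // => /(_ pq).
by lia.
Qed.

Lemma entryE n (e : {ffun 'I_n -> 'I_n}) j :
  entry e j = if j < n then (nth 0 (word e) j)%:Z else (-1)%R.
Proof.
rewrite /entry; case: ifP => [jn|/negbT jn].
  rewrite (nth_word e (Ordinal jn)) (nth_map (Ordinal jn)) ?size_enum_ord //.
  by rewrite (nth_ord_enum _ (Ordinal jn)).
by rewrite nth_default // size_map size_enum_ord leqNgt.
Qed.

(** In [first_descent] the guard [p < size w] of the last clause replaces the convention e_(n+1) =
    -1. *)
Lemma fdes_first_descent {n} (e : {ffun 'I_n -> 'I_n}) :
  0 < n -> first_descent (word e) (fdes e).
Proof.
move=> n0; rewrite /first_descent /fdes size_word.
set P := fun _ => _.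
have hasP : has P (iota 0 n).
  (* At index n - 1 the next entry is the conventional -1, which lies below every entry. *)
  apply/hasP; exists n.-1; rewrite ?mem_iota ?add0n /P ?entryE ?prednK ?leqnn //.
  by rewrite ltnn.
have fn : find P (iota 0 n) < n by rewrite -[X in _ < X](size_iota 0) -has_find.
split=> [//|i|] /=.
  rewrite ltnS => lif; have := before_find 0 lif.
  rewrite nth_iota; last by lia.
  rewrite /P add0n !entryE (leq_ltn_trans lif fn) (ltn_trans lif fn).
  by lia.
move=> fn1; have := nth_find 0 hasP.
by rewrite nth_iota // /P add0n !entryE fn fn1; lia.
Qed.

Lemma fdesP {n} (e : {ffun 'I_n -> 'I_n}) p :
  0 < n -> fdes e = p <-> first_descent (word e) p.
Proof.
move=> n0; split=> [<-|]; first exact: fdes_first_descent.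
exact: first_descent_unique (fdes_first_descent e n0).
Qed.

Lemma leq_max_entry n (e : {ffun 'I_n -> 'I_n}) i :
  nth 0 (word e) i <= max_entry e.
Proof.
case: (ltnP i n) => lin; last by rewrite nth_default ?size_word.
rewrite (nth_word e (Ordinal lin)).
exact: (@leq_bigmax _ (fun j => nat_of_ord (e j))).
Qed.

Lemma max_entryP n (e : {ffun 'I_n -> 'I_n}) i :
  (forall j, j < n -> nth 0 (word e) j <= nth 0 (word e) i) ->
  max_entry e = nth 0 (word e) i.
Proof.
move=> h; apply/eqP; rewrite eqn_leq leq_max_entry andbT.
by apply/bigmax_leqP => j _; rewrite -nth_word h.
Qed.

(** * Weakly increasing inversion sequences and ballot numbers *)

(* The last entry of the empty sequence is taken to be 0. *)
Fixpoint sorted_words p m : seq (seq nat) :=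
  if p is q.+1 then
    if m <= q then
      [seq rcons s m | s <- flatten [seq sorted_words q j | j <- iota 0 m.+1]]
    else [::]
  else nseq (m == 0) [::].

Lemma sorted_wordsS p m :
  sorted_words p.+1 m =
    if m <= p then
      [seq rcons s m | s <- flatten [seq sorted_words p j | j <- iota 0 m.+1]]
    else [::].
Proof. by []. Qed.

Lemma mem_sorted_words p m s :
  (s \in sorted_words p m) =
  [&& size s == p, sorted leq s, last 0 s == m
    & all (fun i => nth 0 s i <= i) (iota 0 p)].
Proof.
elim: p m s => [|p IH] m s.
  rewrite /= mem_nseq lt0b; case: s => [|x s]; rewrite ?andbF //= !andbT.
  by rewrite eq_sym.
rewrite sorted_wordsS; case: (leqP m p) => mp; last first.
  (* The last entry m sits at index p, so m > p breaks the inversion bound there. *)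
  apply/esym/negP => /and4P[/eqP ss _ /eqP sm /allP/(_ p)].
  rewrite mem_iota ltnS leqnn => /(_ isT).
  by rewrite -[p]/(p.+1.-1) -ss nth_last sm ss /=; lia.
case/lastP: s => [|s x].
  by apply/negbTE/mapP => -[[|y s]].
set L := flatten _.
have FP : reflect (exists2 j, j \in iota 0 m.+1 & s \in sorted_words p j)
                  (s \in L) by exact: flatten_mapP.
have -> : (rcons s x \in [seq rcons s m | s <- L]) = (x == m) && (s \in L).
  apply/mapP/andP => [[s' s'i /rcons_inj [-> ->]]|[/eqP -> si]] //.
  by exists s.
rewrite size_rcons eqSS last_rcons -[p.+1]addn1 iotaD all_cat /= andbT add0n.
rewrite nth_rcons.
case: (eqVneq x m) => [->|]; rewrite ?andbF //=.
have -> : sorted leq (rcons s m) = sorted leq s && (last 0 s <= m).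
  by case: (s) => [|y s'] //=; rewrite rcons_path.
apply/FP/and4P.
  move=> [j]; rewrite mem_iota add0n ltnS IH => /= jm.
  case/and4P => /eqP sp ss /eqP lj inv; split; rewrite ?sp ?ss ?lj ?ltnn ?eqxx //.
  apply/allP => i ip.
  move/allP: inv => /(_ i ip); rewrite nth_rcons sp.
  by move: ip; rewrite mem_iota /= add0n => ->.
case=> /eqP sp /andP[ss lm] inv _; exists (last 0 s).
  by rewrite mem_iota.
rewrite IH sp ss !eqxx /=; apply/allP => i ip.
move/allP: inv => /(_ i ip); rewrite nth_rcons sp.
by move: ip; rewrite mem_iota /= add0n => ->.
Qed.

Lemma uniq_sorted_words p m : uniq (sorted_words p m).
Proof.
elim: p m => [|p IH] m; first by rewrite /=; case: (m == 0).
rewrite sorted_wordsS; case: ifP => // _.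
rewrite map_inj_uniq; last by move=> s s' /rcons_inj[].
elim: m.+1 => // k IHk; rewrite -addn1 iotaD map_cat flatten_cat cat_uniq IHk.
rewrite /= cats0 IH andbT; apply/hasPn => s sk.
apply/negP => /flatten_mapP[j]; rewrite mem_iota add0n => jk.
move: sk; rewrite !mem_sorted_words => /and4P[_ _ /eqP-> _] /and4P[_ _ /eqP kj _].
by move: jk; rewrite -kj add0n ltnn andbF.
Qed.

Lemma size_sorted_wordsS p m :
  m <= p ->
  size (sorted_words p.+1 m) = \sum_(0 <= j < m.+1) size (sorted_words p j).
Proof.
move=> mp; rewrite sorted_wordsS mp size_map size_flatten sumnE big_map big_map.
by rewrite /index_iota subn0.
Qed.

(** The last entry sits at index p - 1, which bounds it; [0 < m] excludes the empty word, counted at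
    p = m = 0. *)
Lemma size_sorted_words_gt p m : p <= m -> 0 < m -> size (sorted_words p m) = 0.
Proof. by case: p => [|p] /=; case: ltngtP. Qed.

(** This is the ballot number (p + 1 - m) / (p + 1) * C(p + m, m), kept free of division. Comparing
    the sums of [size_sorted_wordsS] for m and m + 1 gives the ballot recurrence, and the induction
    on p, then on m, follows it. *)
Lemma size_sorted_words p m :
  m <= p -> p.+1 * size (sorted_words p.+1 m) = (p.+1 - m) * 'C(p + m, m).
Proof.
elim: p m => [|p IHp]; first by case.
elim=> [|m IHm] mp.
  rewrite size_sorted_wordsS // big_nat1.
  by have := IHp 0 isT; rewrite !bin0 !subn0; nia.
have -> : size (sorted_words p.+2 m.+1) =
          size (sorted_words p.+2 m) + size (sorted_words p.+1 m.+1).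
  rewrite (size_sorted_wordsS p.+1 m.+1 mp) big_nat_recr //=.
  by rewrite (size_sorted_wordsS p.+1 m (ltnW mp)).
have {IHm} := IHm (ltnW mp).
have : p.+1 * size (sorted_words p.+1 m.+1) =
       (p.+1 - m.+1) * 'C(p + m.+1, m.+1).
  (* At m = p the hypothesis [IHp] is out of range, but both sides vanish. *)
  case: (leqP m.+1 p) => mp'; first exact: IHp.
  have -> : m = p by lia.
  by rewrite size_sorted_words_gt // subnn muln0.
move: (size _) (size _) => x y.
rewrite !addSn !addnS => hx hy.
have := binS (p + m).+1 m; have := mul_bin_left (p + m).+1 m.
set c := 'C((p + m).+1, m) in hy *; set d := 'C(_, m.+1) in hx *.
have -> : (p + m).+1 - m = p.+1 by lia.
move=> cd ->.
have [k pk] : exists k, p = m + k by exists (p - m); lia.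
have -> : p.+2 - m.+1 = k.+1 by lia.
have {}hx : p.+1 * y = k * d by rewrite hx; congr (_ * _); lia.
have {}hy : p.+2 * x = k.+2 * c by rewrite hy; congr (_ * _); lia.
(* After multiplication by p + 1 both [hx] and [hy] apply; what remains reduces to [cd], that is (m
   + 1) d = (p + 1) c. *)
apply/eqP; rewrite -(eqn_pmul2l (ltn0Sn p)); apply/eqP.
have -> : p.+1 * (p.+2 * (x + y)) = p.+1 * (p.+2 * x) + p.+2 * (p.+1 * y) by ring.
rewrite hx hy; subst p; move: cd; nia.
Qed.

Local Arguments sorted_words : simpl never.

(** * Structure of the avoiding words *)

Definition zero_tail (n p m : nat) (w : seq nat) :=
  [/\ size w = n,
      forall i, i < p -> nth 0 w i <= i,
      forall i, i.+1 < p -> nth 0 w i <= nth 0 w i.+1,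
      nth 0 w p.-1 = m
    & forall i, p <= i -> nth 0 w i = 0].

(** For m > 0, [a] is the index of the first m, so [m <= a] is the inversion condition there; it
    then holds at all later occurrences of m. *)
Definition recurring_tail (n p m : nat) (w : seq nat) :=
  size w = n /\
  exists2 a, m <= a < p &
    [/\ forall i, i < a -> nth 0 w i = 0,
        forall i, a <= i < p -> nth 0 w i = m,
        nth 0 w p = 0,
        forall i, p < i -> nth 0 w i = 0 \/ nth 0 w i = m
      & exists2 k, p < k < n & nth 0 w k = m].

(** The two triple conditions are avoidance of 102 and of 021. The last clause stands in for max =
    m: by [avoiding_word_max] the entry just before the first descent is the maximum. *)
Definition avoiding_word (n p m : nat) (w : seq nat) :=
  [/\ forall i, i < n -> nth 0 w i <= i,
      forall i j k, i < j -> j < k -> k < n ->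
        ~~ (nth 0 w j < nth 0 w i < nth 0 w k),
      forall i j k, i < j -> j < k -> k < n ->
        ~~ (nth 0 w i < nth 0 w k < nth 0 w j),
      first_descent w p
    & nth 0 w p.-1 = m].

Lemma leq_prefix p w :
  (forall i, i.+1 < p -> nth 0 w i <= nth 0 w i.+1) ->
  forall i j, i <= j -> j < p -> nth 0 w i <= nth 0 w j.
Proof.
move=> h i; elim=> [|j IH]; first by rewrite leqn0 => /eqP->.
rewrite leq_eqVlt => /predU1P[-> //|ij] jp.
exact: leq_trans (IH ij (ltnW jp)) (h _ jp).
Qed.

(** An entry after index p exceeding m would complete the descent at p - 1, p to a 102. *)
Lemma avoiding_word_max n p m w :
  size w = n -> avoiding_word n p m w ->
  forall i, i < n -> nth 0 w i <= m.
Proof.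
move=> sw [inv av102 av021 [/andP[p0 pn] inc des] wm] i lin.
have mono := leq_prefix _ _ inc.
rewrite sw in pn des.
case: (ltnP i p) => ip; first by rewrite -wm; apply: mono; lia.
case: (ltngtP p i) ip => // [pi|pi] _; last by subst i; lia.
by have := av102 p.-1 p i; lia.
Qed.

Lemma avoiding_wordP n p m w :
  size w = n -> 0 < m < p -> p <= n ->
  avoiding_word n p m w <-> zero_tail n p m w \/ recurring_tail n p m w.
Proof.
move=> sw /andP[m0 mp] pn; split.
  move=> av; have maxm := avoiding_word_max _ _ _ _ sw av.
  case: av => inv av102 av021 [_ inc des] wm; rewrite sw in des.
  have mono := leq_prefix _ _ inc.
  have w0 : nth 0 w 0 = 0 by have := inv 0; lia.
  have out i : n <= i -> nth 0 w i = 0 by move=> ?; rewrite nth_default ?sw.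
  (* A nonzero value here would give a 021 at indices 0, p - 1, p; for p = n the value is the
     default 0. *)
  have wp : nth 0 w p = 0.
    case: (ltnP p n) => [pn'|/out //].
    have := des pn'; have := av021 0 p.-1 p; lia.
  (* A value strictly between 0 and m would give a 021 at indices 0, p - 1, i. *)
  have tail i : p < i -> nth 0 w i = 0 \/ nth 0 w i = m.
    move=> pi; case: (ltnP i n) => [lin|/out ->]; last by left.
    by have := av021 0 p.-1 i; have := maxm i lin; lia.
  (* The two families differ in whether m occurs after index p. *)
  case: (boolP (has (pred1 m) (drop p.+1 w))) => [/(has_nthP 0)|/hasPn nm].
    case=> k; rewrite size_drop sw nth_drop => ks /eqP wk; right; split=> //.
    have hasn : has (predC1 0) w.
      by apply/(has_nthP 0); exists p.-1; rewrite ?sw /= ?wm; lia.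
    have := nth_find 0 hasn; have := before_find 0 (s := w) (a := predC1 0).
    set a := find _ _ => /= bef wa.
    have ap : a <= p.-1.
      rewrite leqNgt; apply/negP => /bef; rewrite wm; lia.
    (* From the first nonzero index a on, an entry below m would form a 102 with the 0 at p and the
       m at [p.+1 + k]. *)
    have mid i : a <= i < p -> nth 0 w i = m.
      move=> aip; have := mono a i; have := av102 i p (p.+1 + k).
      have := mono i p.-1.
      by lia.
    exists a; first by have := inv a; have := mid a; lia.
    split=> //; first by move=> i /bef /negbFE/eqP.
    by exists (p.+1 + k); rewrite // ; lia.
  left; split=> // [i ip|i pi]; first by apply: inv; lia.
  case: (ltngtP p i) pi => // [pi|<- //] _.
  case: (tail i pi) => // wi.
  have /nm : m \in drop p.+1 w; last by rewrite /= eqxx.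
  have lin : i < n by rewrite ltnNge; apply: contraL m0 => /out; rewrite wi => ->.
  apply/(nthP 0); exists (i - p.+1); first by rewrite size_drop sw; lia.
  by rewrite nth_drop subnKC.
case=> [[_ inv inc wm tail]|[_ [a /andP[ma ap] [z mid wp tail [k0 k0n wk0]]]]].
  have mono := leq_prefix _ _ inc.
  (* A nonzero entry dominates all earlier ones, so it cannot be the last letter of a 021. *)
  have inc' i j : i < j -> nth 0 w i <= nth 0 w j \/ nth 0 w j = 0.
    move=> ij; case: (ltnP j p) => [jp|/tail]; last by right.
    by left; apply: mono => //; lia.
  split=> //.
  - move=> i lin; case: (ltnP i p) => [/inv//|/tail ->//].
  - move=> i j k ij jk kn.
    by have := mono i j; have := tail k; lia.
  - move=> i j k ij jk kn.
    by have := inc' j k jk; lia.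
  - split; rewrite ?sw //; first by lia.
    by move=> _; rewrite wm tail.
(* Only the values 0 and m occur, while both patterns need three distinct values. The positions
   serve the inversion bound and the descent. *)
have val i : [\/ i < a /\ nth 0 w i = 0, a <= i < p /\ nth 0 w i = m
                | p <= i /\ (nth 0 w i = 0 \/ nth 0 w i = m)].
  case: (ltnP i a) => [ia|ai]; first by constructor 1; rewrite z.
  case: (ltnP i p) => [ip|pi]; first by constructor 2; split; [|apply: mid]; lia.
  constructor 3; split=> //; case: (ltngtP p i) pi => [/tail //||<-] // _.
  by left.
split.
- by move=> i lin; case: (val i); lia.
- move=> i j k ij jk kn.
  by case: (val i); case: (val j); case: (val k); lia.
- move=> i j k ij jk kn.
  by case: (val i); case: (val j); case: (val k); lia.
- split; rewrite ?sw; first by lia.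
    by move=> i ip; case: (val i); case: (val i.+1); lia.
  by move=> _; rewrite wp mid; lia.
- by rewrite mid; lia.
Qed.

(** * Enumeration of the two families *)

Definition zero_tail_words (n p m : nat) : seq (seq nat) :=
  [seq s ++ nseq (n - p) 0 | s <- sorted_words p m].

(** [rem] deletes a single occurrence, which suffices because the list of all words of k bits has no
    repetition. *)
Definition nonzero_bits k : seq bitseq :=
  rem (nseq k false) [seq val u | u <- enum {: k.-tuple bool}].

(** For n = p the truncated [n - p.+1] is 0 and [nonzero_bits 0] is empty, so no word of the wrong
    length p + 1 is listed. *)
Definition recurring_tail_words (n p m : nat) : seq (seq nat) :=
  [seq nseq a 0 ++ nseq (p - a) m ++ 0 :: [seq b * m | b : bool <- u]
     | a <- iota m (p - m), u <- nonzero_bits (n - p.+1)].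

Lemma zero_tail_wordsP {n p m w} :
  0 < p <= n -> reflect (zero_tail n p m w) (w \in zero_tail_words n p m).
Proof.
move=> /andP[p0 pn]; apply: (iffP mapP) => [[s]|].
  rewrite mem_sorted_words => /and4P[/eqP sp /(sortedP 0) ss /eqP sm /allP inv] ->.
  split.
  - by rewrite size_cat size_nseq sp subnKC.
  - by move=> i ip; rewrite nth_cat sp ip inv // mem_iota.
  - by move=> i ip; rewrite !nth_cat sp ip (ltnW ip); apply: ss; rewrite sp.
  - by rewrite nth_cat sp prednK // leqnn -sp nth_last.
  - by move=> i pi; rewrite nth_cat sp ltnNge pi nth_nseq if_same.
case=> sw inv inc wm tail; exists (take p w).
  have stp : size (take p w) = p by rewrite size_take_min sw; lia.
  rewrite mem_sorted_words stp eqxx /=; apply/and3P; split.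
  - apply/(sortedP 0) => i; rewrite stp => ip.
    by rewrite !nth_take ?(ltnW ip) ?ip // inc.
  - by rewrite -nth_last stp nth_take ?prednK ?wm.
  - by apply/allP => i; rewrite mem_iota => /andP[_ ip]; rewrite nth_take // inv.
rewrite -{1}(cat_take_drop p w); congr (_ ++ _).
apply: (@eq_from_nth _ 0); rewrite size_drop ?size_nseq sw // => i _.
by rewrite nth_drop nth_nseq if_same tail // leq_addr.
Qed.

Lemma uniq_nonzero_bits k : uniq (nonzero_bits k).
Proof. by rewrite rem_uniq // map_inj_uniq ?enum_uniq //; exact: val_inj. Qed.

Lemma mem_nonzero_bits k u :
  (u \in nonzero_bits k) = (size u == k) && (true \in u).
Proof.
rewrite mem_rem_uniq; last by rewrite map_inj_uniq ?enum_uniq //; exact: val_inj.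
rewrite inE /= andbC.
have -> : (u \in [seq val u | u <- enum {: k.-tuple bool}]) = (size u == k).
  apply/mapP/eqP => [[v _ ->]|/eqP su]; first by rewrite size_tuple.
  by exists (Tuple su); rewrite ?mem_enum.
case: eqP => //= <-.
by elim: u => [|[] u IH] //=; rewrite inE -IH.
Qed.

Lemma size_nonzero_bits k : size (nonzero_bits k) = 2 ^ k - 1.
Proof.
rewrite size_rem; first by rewrite size_map -cardE card_tuple card_bool subn1.
by apply/mapP; exists [tuple of nseq k false]; rewrite ?mem_enum.
Qed.

Lemma recurring_tail_wordsP {n p m w} :
  0 < m < p -> p <= n ->
  reflect (recurring_tail n p m w) (w \in recurring_tail_words n p m).
Proof.
move=> /andP[m0 mp] pn; apply: (iffP allpairsP).
  move=> [[a u] /= [+ + ->]]; rewrite mem_iota mem_nonzero_bits => ai.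
  move=> /andP[/eqP su tu].
  have pn' : p < n by case: (u) su tu => //= b v su _; lia.
  have nthE i :
    nth 0 (nseq a 0 ++ nseq (p - a) m ++ 0 :: [seq b * m | b : bool <- u]) i =
    if i < a then 0 else if i < p then m else
    if i == p then 0 else nth false u (i - p.+1) * m.
    rewrite nth_cat size_nseq nth_nseq; case: ltnP => ia; first by [].
    rewrite nth_cat size_nseq nth_nseq ltn_subLR // subnKC; last by lia.
    case: (ltngtP i p) => // [pi|->]; last by rewrite subnn.
    have -> : i - a - (p - a) = (i - p.+1).+1 by lia.
    rewrite /=; case: (ltnP (i - p.+1) (size u)) => iu.
      by rewrite (nth_map false).
    by rewrite !nth_default ?size_map.
  split; first by rewrite !size_cat /= !size_nseq size_map su; lia.
  exists a; first by lia.
  split.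
  - by move=> i ia; rewrite nthE ia.
  - by move=> i /andP[ai' ip]; rewrite nthE ltnNge ai' /= ip.
  - by rewrite nthE ltnn eqxx ifF //; lia.
  - by move=> i pi; rewrite nthE !ifF; [case: nth; rewrite ?mul1n; auto|lia..].
  - move/(nthP false): tu => [j ju uj]; exists (p.+1 + j); first by rewrite su in ju; lia.
    by rewrite nthE !ifF ?addKn ?uj ?mul1n //; lia.
move=> [sw [a map_ [z mid wp tail [k kn wk]]]].
exists (a, [seq x == m | x <- drop p.+1 w]); split=> /=.
- by rewrite mem_iota; lia.
- rewrite mem_nonzero_bits size_map size_drop sw eqxx /=.
  apply/mapP; exists m; rewrite ?eqxx //.
  apply/(nthP 0); exists (k - p.+1); first by rewrite size_drop sw; lia.
  by rewrite nth_drop subnKC //; lia.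
apply: (@eq_from_nth _ 0).
  by rewrite !size_cat /= !size_nseq !size_map size_drop sw; lia.
move=> i lin; rewrite nth_cat size_nseq nth_nseq; case: ltnP => ia; first exact: z.
rewrite nth_cat size_nseq nth_nseq ltn_subLR // subnKC; last by lia.
case: (ltngtP i p) => [ip|pi|->]; [by apply: mid; lia| |by rewrite subnn].
have -> : i - a - (p - a) = (i - p.+1).+1 by lia.
rewrite /= (nth_map false) ?size_map ?size_drop ?sw; last by lia.
rewrite (nth_map 0) ?size_drop ?nth_drop ?subnKC ?sw //; last by lia.
by case: (tail i pi) => ->; rewrite ?eqxx ?mul1n //; case: eqP => // <-.
Qed.

Lemma uniq_zero_tail_words n p m : uniq (zero_tail_words n p m).
Proof.
rewrite map_inj_in_uniq ?uniq_sorted_words // => s s'.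
rewrite !mem_sorted_words => /andP[/eqP ss _] /andP[/eqP ss' _] /eqP.
by rewrite eqseq_cat ?ss // => /andP[/eqP].
Qed.

Lemma uniq_recurring_tail_words n p m :
  0 < m -> uniq (recurring_tail_words n p m).
Proof.
move=> m0; apply: allpairs_uniq; rewrite ?iota_uniq ?uniq_nonzero_bits //.
move=> [a u] [a' u'] /allpairsP[[b v] /= [hb _ [-> ->]]].
move=> /allpairsP[[b' v'] /= [hb' _ [-> ->]]].
move: hb hb'; rewrite !mem_iota => ha ha' /=; rewrite !catA => /eqP.
rewrite eqseq_cat; last by rewrite !size_cat !size_nseq; lia.
(* The number of zeros in the prefix 0^a m^(p-a) recovers a, because m is nonzero. *)
case/andP => /eqP/(congr1 (count_mem 0)) + /eqP[].
rewrite !count_cat !count_nseq /= eqn0Ngt m0 !addn0 !mul1n => -> /inj_map-> //.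
by move=> x y /eqP; rewrite eqn_pmul2r //; case: x; case: y.
Qed.

Lemma size_recurring_tail_words n p m :
  size (recurring_tail_words n p m) = (p - m) * (2 ^ (n - p.+1) - 1).
Proof. by rewrite size_allpairs size_iota size_nonzero_bits. Qed.

Lemma size_zero_tail_words n p m :
  size (zero_tail_words n p m) = size (sorted_words p m).
Proof. exact: size_map. Qed.

(** * Counting with rank and maximum fixed *)

Lemma card_avoiding_rank_max n t m :
  0 < m -> m + t < n ->
  #|[set e : {ffun 'I_n -> 'I_n} |
      [&& is_inversion_sequence e, avoids e [tuple 1; 0; 2],
          avoids e [tuple 0; 2; 1], rank e == Posz t & max_entry e == m]]| =
  size (sorted_words (m + t).+1 m) + t.+1 * (2 ^ (n - (m + t).+2) - 1).
Proof.
(* Rank t and maximum m put the first descent at p = m + t + 1. Thus [mtn] says p <= n, and the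
   factor t + 1 is the number p - m of choices for a. *)
move=> m0 mtn; set p := (m + t).+1; set S := [set e | _].
have mp : 0 < m < p by rewrite /p; lia.
have memS e : (e \in S) <-> avoiding_word n p m (word e).
  rewrite inE; split.
    case/and5P => /is_inversion_sequenceP inv /avoidsP av /avoidsP av' /eqP re /eqP me.
    have fd := fdes_first_descent e (leq_ltn_trans (leq0n _) mtn).
    have fp : fdes e = p by move: re; rewrite /rank me /p; lia.
    rewrite fp in fd.
    have {}av i j k : i < j -> j < k -> k < n ->
        ~~ (nth 0 (word e) j < nth 0 (word e) i < nth 0 (word e) k).
      by move=> *; rewrite -order_isomorphic_102 av.
    have {}av' i j k : i < j -> j < k -> k < n ->
        ~~ (nth 0 (word e) i < nth 0 (word e) k < nth 0 (word e) j).
      by move=> *; rewrite -order_isomorphic_021 av'.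
    (* The entry before the descent is not yet known to be m, so it first serves as its own
       parameter; [avoiding_word_max] then identifies it with the maximum. *)
    have aw : avoiding_word n p (nth 0 (word e) p.-1) (word e) by split.
    have mx := avoiding_word_max _ _ _ _ (size_word _ e) aw.
    by case: aw => ? ? ? ? _; split=> //; rewrite -me -(max_entryP _ _ p.-1).
  move=> aw; have mx := avoiding_word_max _ _ _ _ (size_word _ e) aw.
  case: aw => inv av av' fd wm.
  have me : max_entry e = m by rewrite (max_entryP _ _ p.-1) wm.
  apply/and5P; split; last by rewrite me.
  - exact/is_inversion_sequenceP.
  - by apply/avoidsP => *; rewrite order_isomorphic_102 av.
  - by apply/avoidsP => *; rewrite order_isomorphic_021 av'.
  - have /fdesP fp := fd; rewrite /rank me fp /p; lia.
rewrite cardE -(size_map word).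
have -> : t.+1 = p - m by rewrite /p; lia.
rewrite -(size_zero_tail_words n) -size_recurring_tail_words -size_cat.
apply/perm_size/uniq_perm.
- by rewrite map_inj_uniq ?enum_uniq //; exact: word_inj.
- rewrite cat_uniq uniq_zero_tail_words uniq_recurring_tail_words // andbT /=.
  (* The families are disjoint: a nonzero m after index p contradicts a zero tail. *)
  apply/hasPn => w /(recurring_tail_wordsP mp mtn)[sw [a _ [_ _ _ _ [k kn wk]]]].
  apply/negP => /(zero_tail_wordsP _)[] // _ _ _ _ /(_ k).
  by rewrite wk => /(_ _); lia.
move=> w; rewrite mem_cat; apply/mapP/orP.
  move=> [e]; rewrite mem_enum => /memS /avoiding_wordP aw ->.
  case: (aw (size_word _ e) mp mtn) => [z|r]; [left|right].
    exact/zero_tail_wordsP.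
  exact/recurring_tail_wordsP.
have pn : 0 < p <= n by [].
move=> zr; have [sw aw] : size w = n /\ avoiding_word n p m w.
  have zr' : zero_tail n p m w \/ recurring_tail n p m w.
    by case: zr => [/(zero_tail_wordsP pn)|/(recurring_tail_wordsP mp mtn)]; auto.
  have sw : size w = n by case: zr' => -[].
  by split=> //; apply/avoiding_wordP.
have [e we] : exists e : {ffun 'I_n -> 'I_n}, word e = w.
  by apply: wordP sw _; case: aw.
by exists e; rewrite // mem_enum; apply/memS; rewrite we.
Qed.

(** * Summation over the maximum *)

Lemma card_fibers (T : finType) (A : {set T}) (f : T -> nat) (s : seq nat) :
  uniq s -> {in A, forall x, f x \in s} ->
  #|A| = \sum_(m <- s) #|[set x in A | f x == m]|.
Proof.
move=> us fs; under eq_bigr => m _.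
  rewrite -sum1_card; under eq_bigl => x do rewrite inE.
  rewrite big_mkcondr; over.
rewrite exchange_big -sum1_card; apply: eq_bigr => x xA /=.
rewrite -big_mkcond sum1_count (eq_count (a2 := pred1 (f x))).
  by rewrite count_uniq_mem ?fs.
by move=> m; rewrite /= eq_sym.
Qed.

(** If the maximum were 0, then fdes = t + 1 < n would require a descent from an entry 0. The upper
    bound is fdes <= n. *)
Lemma max_entry_range n t (e : {ffun 'I_n -> 'I_n}) :
  0 < n -> t.+1 < n -> rank e = Posz t -> max_entry e \in index_iota 1 (n - t).
Proof.
move=> n0 tn re; have [/andP[p0 pn] _ des] := fdes_first_descent e n0.
rewrite size_word in pn des; rewrite mem_index_iota.
have pmt : fdes e = (max_entry e + t).+1 by move: re; rewrite /rank; lia.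
have := leq_max_entry _ e (fdes e).-1.
by move: des; lia.
Qed.

(** A geometric sum, with k + 1 moved to the left to avoid subtraction. The term m = k + 1 is 2^0 -
    1 = 0 by truncation; it is kept so that, for k = n - t - 2, m runs over all possible maxima 1,
    ..., n - t - 1. *)
Lemma sum_expn2_pred k :
  \sum_(1 <= m < k.+2) (2 ^ (k - m) - 1) + k.+1 = 2 ^ k.
Proof.
elim: k => [|k IH]; first by rewrite big_nat1.
rewrite big_ltn // big_add1 /=.
under eq_bigr => m _ do rewrite subSS.
have : 0 < 2 ^ k by rewrite expn_gt0.
by rewrite expnS subSS subn0; lia.
Qed.

Local Open Scope ring_scope.

Lemma size_sorted_words_ballot t m :
  (size (sorted_words (m + t).+1 m))%:R
  = (t + 1)%:R * ((m + t + 1)%:R^-1 * 'C(2 * m + t, m)%:R) :> rat.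
Proof.
have /(congr1 (fun k => k%:R : rat)) := size_sorted_words (m + t) m (leq_addr _ _).
rewrite !natrM -addn1 => h.
have nz : (m + t + 1)%:R != 0 :> rat by rewrite pnatr_eq0 addn1.
apply: (mulfI nz); rewrite h.
have -> : (m + t + 1 - m = t + 1)%N by lia.
have -> : (m + t + m = 2 * m + t)%N by lia.
by rewrite [RHS]mulrCA mulVKf.
Qed.

Theorem proposition5p7 (n t : nat) (hn : (2 <= n)%N) (ht : (t <= n - 2)%N) :
  (#|[set e : {ffun 'I_n -> 'I_n} |
       [&& is_inversion_sequence e, avoids e [tuple 1%N; 0%N; 2%N],
           avoids e [tuple 0%N; 2%N; 1%N] & rank e == Posz t]]|)%:R
  = (t + 1)%:R *
    (2 ^+ (n - t - 2) - (n - t - 1)%:R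
     + \sum_(1 <= m < n - t) (m + t + 1)%:R^-1 * 'C(2 * m + t, m)%:R)
  :> rat.
Proof.
have n0 : (0 < n)%N by lia.
have tn : (t.+1 < n)%N by lia.
rewrite (card_fibers _ _ (@max_entry n) _ (iota_uniq 1 (n - t - 1))); last first.
  by move=> e; rewrite inE => /and4P[_ _ _ /eqP re]; apply: max_entry_range.
rewrite -/(index_iota 1 (n - t)) big_nat.
under eq_bigr => m mr.
  under eq_finset => e do rewrite inE -!andbA.
  rewrite card_avoiding_rank_max; [over|lia|lia].
rewrite -big_nat big_split -big_distrr /= natrD natr_sum natrM -(addn1 t).
under eq_bigr => m _ do rewrite size_sorted_words_ballot.
rewrite -mulr_sumr -mulrDr addrC; congr (_ * (_ + _)).
(* Writing n = k + t + 2 turns the recurring part into [sum_expn2_pred], whose value is 2^k - (k +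
   1). *)
have [k nk] : exists k, n = (k + t).+2 by exists (n - t - 2)%N; lia.
have -> : (n - t - 2 = k)%N by lia.
have -> : (n - t - 1 = k.+1)%N by lia.
have -> : (n - t = k.+2)%N by lia.
under eq_bigr => m _ do (have -> : (n - (m + t).+2 = k - m)%N by lia).
by rewrite -natrX -(sum_expn2_pred k) natrD addrK.
Qed.
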